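(* Let $k$ be a positive integer and $m$ a nonnegative integer. Then \[ \gamma_{A(k)}(m)=\lim_{x\to\infty}\left(\sum_{n\le x}\frac{A_n(k)\log^{m}n}{n}-\frac1k\frac{\log^{m+2}x}{m+2}-\frac{\gamma}{k}\frac{\log^{m+1}x}{m+1}\right). \]
   Context: For a positive integer $k$, define $A_n(k)$ ($n\ge1$) by $-\frac{\log(1-x)}{1-x^k}=\sum_{n=1}^{\infty}A_n(k)x^n$, and $\zeta_{A(k)}(s)=\sum_{n\ge1}A_n(k)n^{-s}$ for $\operatorname{Re}(s)>1$. This function extends meromorphically to $\mathbb{C}$, and near $s=1$ has the Laurent expansion \[ \zeta_{A(k)}(s)=\frac{1}{k(s-1)^2}+\frac{\gamma}{k(s-1)}+\sum_{m=0}^{\infty}(-1)^m\frac{\gamma_{A(k)}(m)}{m!}(s-1)^m, \] which defines the constants $\gamma_{A(k)}(m)$. Here $\gamma$ is the Euler–Mascheroni constant. *)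

(* Defs.v *)
From Stdlib Require Import Reals Factorial.
From Coquelicot Require Import Coquelicot.
Open Scope R_scope.

(* The coefficients are determined by the identity on the open unit interval;
   taking x = 0 forces A 0 = 0, so the series does start at n = 1. *)
Definition is_A_coeffs (k : nat) (A : nat -> R) : Prop :=
  forall x : R, Rabs x < 1 -> is_pseries A x (- (ln (1 - x) / (1 - x ^ k))).

Definition euler_gamma : R :=
  real (Lim_seq (fun n => sum_n_m (fun j => / INR j) 1 n - ln (INR n))).

Definition Cexp (z : C) : C :=
  (exp (Re z) * cos (Im z), exp (Re z) * sin (Im z)).

(* n ^ s for an integer n >= 1, with the real logarithm of n. *)
Definition nat_Cpow (n : nat) (s : C) : C := Cexp (s * RtoC (ln (INR n)))%C.

(* Near z0, off z0 itself, f is the quotient of a function holomorphic in a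
   neighbourhood of z0 by a power of (z - z0).  The value f z0 is unconstrained,
   as is usual for a total function standing for a meromorphic one. *)
Definition meromorphic_at (f : C -> C) (z0 : C) : Prop :=
  exists (N : nat) (h : C -> C),
    locally z0 (fun z => @ex_derive C_AbsRing C_NormedModule h z) /\
    locally' z0 (fun z => f z = (h z / (z - z0) ^ N)%C).

(* Z is the meromorphic continuation to the whole plane of the Dirichlet series
   of the coefficients A n, n >= 1 (is_series is indexed from 0). *)
Definition is_zeta_A (A : nat -> R) (Z : C -> C) : Prop :=
  (forall z : C, meromorphic_at Z z) /\
  (forall s : C, 1 < Re s ->
     @is_series C_AbsRing C_NormedModule
       (fun n => RtoC (A (S n)) * nat_Cpow (S n) (- s))%C (Z s)).

(* The Laurent expansion at s = 1, stated after moving the principal part to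
   the other side so that the regular part is a convergent power series. *)
Definition is_gamma_A (k : nat) (Z : C -> C) (g : nat -> C) : Prop :=
  locally' (RtoC 1) (fun s : C =>
    @is_pseries C_AbsRing C_NormedModule
      (fun j => RtoC ((-1) ^ j) * g j / RtoC (INR (fact j)))%C
      (s - RtoC 1)%C
      (Z s - RtoC 1 / (RtoC (INR k) * (s - RtoC 1) ^ 2)
           - RtoC euler_gamma / (RtoC (INR k) * (s - RtoC 1)))%C).

Definition nat_floor (x : R) : nat := Z.to_nat (Int_part x).

(* Main.v *)
(* Let A n be the sum of 1/i over 1 <= i <= n with i = n mod k.  Any k consecutive
   values of A add up to a harmonic number, so summation by parts against the slowly
   varying log^m n / n replaces A n by H_n / k up to a convergent series; with
   H_n = log n + gamma + O(1/n), the limit L on the right-hand side exists.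

   For real t > 0 let G_m(t) be the Dirichlet series of A n * log^m n / n at t minus
   (m+1)!/(k t^(m+2)) + gamma m!/(k t^(m+1)).  An Abelian theorem gives G_m(t) -> L
   as t -> 0+.  On the other hand G_m' = - G_(m+1) and G_0 is the regular part of
   Z(1+t), so G_m is, up to sign, the m-th derivative of the power series with
   coefficients (-1)^j g_j / j!, and G_m(t) -> g_m. *)

Require Import Defs.
From Stdlib Require Import Reals Lra Lia ZArith.
From Coquelicot Require Import Coquelicot.
Open Scope R_scope.

(** * Recurrence for the coefficients *)

(** For k >= 2 the difference A n - (log n + gamma)/k need not tend to 0: it settles to a constant
    depending on n mod k. Absolute comparison term by term therefore fails, and cancellation over k
    consecutive indices has to be exploited. The principal part is forced by the terms subtracted in
    the limit. With y = log x they form the primitive of (y + gamma) y^m / k, and integrating that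
    density against exp (- t y) over y > 0 gives exactly (m+1)!/(k t^(m+2)) + gamma m!/(k t^(m+1)).
    The operator - d/dt carries these fractions to those of m+1, as it does the Dirichlet series,
    whence G_m' = - G_(m+1). All analysis stays on the real ray s = 1 + t, t > 0, where the values
    of a power series already determine its coefficients. *)

Lemma pow_n_Rpow (x : R) (n : nat) : @pow_n R_AbsRing x n = x ^ n.
Proof. exact (pow_n_pow x n). Qed.

Lemma CV_radius_ge (a : nat -> R) (x : R) :
  ex_pseries a x -> Rbar_le (Rabs x) (CV_radius a).
Proof.
intros H; apply Rbar_not_lt_le; intros Hlt.
apply (CV_disk_outside a x Hlt).
apply ex_series_lim_0; revert H; apply ex_series_ext; intros n.
rewrite (pow_n_Rpow _ n); apply Rmult_comm.
Qed.

(** Multiplying the generating function by 1 - x^k leaves - log (1 - x), so the coefficients of [B],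
    which is A minus its shift by k, are those of the logarithm. *)
Lemma A_coeffs_recurrence (k : nat) (A : nat -> R) :
  (1 <= k)%nat -> is_A_coeffs k A ->
  A 0%nat = 0 /\ (forall n, A (S n) = A (S n - k)%nat + / INR (S n)).
Proof.
intros hk hA.
set (B := fun n => A n - PS_incr_n A k n).
assert (HB : forall x, Rabs x < 1 -> is_pseries B x (- ln (1 - x))).
{ intros x Hx.
  pose proof (hA x Hx) as H1.
  pose proof (is_pseries_incr_n A k x _ H1) as H2.
  pose proof (is_pseries_minus _ _ _ _ _ H1 H2) as H3.
  change (is_pseries B x (- (ln (1 - x) / (1 - x ^ k))
                          - @pow_n R_AbsRing x k * - (ln (1 - x) / (1 - x ^ k)))) in H3.
  rewrite (pow_n_Rpow x k) in H3.
  replace (- ln (1 - x)) with (- (ln (1 - x) / (1 - x ^ k))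
                          - x ^ k * - (ln (1 - x) / (1 - x ^ k))); [exact H3|].
    assert (x ^ k <> 1).
    { intros E. assert (Rabs (x ^ k) < 1).
      { apply Rabs_def2 in Hx. rewrite <- RPow_abs.
        destruct k as [|k]; [lia|]. simpl.
        assert (0 <= Rabs x < 1) by (split; [apply Rabs_pos | apply Rabs_def1; lra]).
        assert (Rabs x ^ k <= 1 ^ k) by (apply pow_incr; lra).
        rewrite pow1 in H0. assert (0 <= Rabs x ^ k) by (apply pow_le; lra). nra. }
      rewrite E, Rabs_R1 in H; lra. }
    field; lra. }
assert (Hrad : Rbar_le 1 (CV_radius B)).
{ apply Rbar_not_lt_le; intros Hlt.
  pose proof (CV_radius_ge_0 B) as H0.
  destruct (CV_radius B) as [r| |] eqn:E; simpl in *; try easy.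
  pose (x := (r + 1) / 2).
  assert (Hx : Rabs x < 1) by (unfold x; apply Rabs_def1; lra).
  assert (Hx2 := CV_radius_ge B x (ex_intro _ _ (HB x Hx))).
  rewrite E in Hx2; simpl in Hx2. unfold x in Hx2.
  rewrite Rabs_pos_eq in Hx2; lra. }
assert (Hval : forall x, Rabs x < 1 -> PSeries B x = - ln (1 - x)).
{ intros x Hx; apply is_pseries_unique, HB, Hx. }
assert (HB0 : B 0%nat = 0).
{ rewrite <- (PSeries_0 B), Hval by (rewrite Rabs_R0; lra).
  rewrite Rminus_0_r, ln_1; ring. }
(* Differentiation replaces the logarithm by the geometric series, and uniqueness of power series
   coefficients does the rest. *)
assert (HBS : forall n, INR (S n) * B (S n) = 1).
{ intros n. change (PS_derive B n = (fun _ => 1) n).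
  apply PSeries_ext_recip.
  - rewrite CV_radius_derive. apply Rbar_lt_le_trans with 1; [simpl; lra | exact Hrad].
  - apply Rbar_lt_le_trans with (Rabs (1/2)); [simpl; rewrite Rabs_pos_eq; lra|].
    apply CV_radius_ge. exists (/ (1 - 1/2)).
    apply (proj2 (is_pseries_R _ _ _)), is_series_ext with (fun n => (1/2)^n).
    + intros i; symmetry; apply Rmult_1_l.
    + apply is_series_geom; rewrite Rabs_pos_eq; lra.
  - exists (mkposreal 1 Rlt_0_1). intros x Hx.
    change (Rabs (x - 0) < 1) in Hx. rewrite Rminus_0_r in Hx.
    rewrite <- Derive_PSeries
      by (apply Rbar_lt_le_trans with 1; [simpl; lra | exact Hrad]).
    transitivity (/ (1 - x)).
    + rewrite (Derive_ext_loc _ (fun x => - ln (1 - x))).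
      * apply is_derive_unique. apply Rabs_def2 in Hx. auto_derive; [lra|field; lra].
      * apply Rabs_def2 in Hx.
        assert (Hp : 0 < Rmin (1 - x) (1 + x)) by (apply Rmin_pos; lra).
        exists (mkposreal _ Hp). intros y Hy.
        change (Rabs (y - x) < Rmin (1 - x) (1 + x)) in Hy.
        pose proof (Rmin_l (1-x) (1+x)). pose proof (Rmin_r (1-x) (1+x)).
        apply Hval. apply Rabs_def2 in Hy; apply Rabs_def1; lra.
    + symmetry; apply is_pseries_unique.
      apply (proj2 (is_pseries_R _ _ _)), is_series_ext with (fun n => x^n).
      * intros i; symmetry; apply Rmult_1_l.
      * apply is_series_geom; exact Hx. }
assert (HA0 : A 0%nat = 0).
{ unfold B in HB0. rewrite PS_incr_n_simplify in HB0.
  destruct (Compare_dec.le_lt_dec k 0) as [h|h]; [lia|].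
  change (A 0%nat - 0 = 0) in HB0; lra. }
split; [exact HA0|]. intros n.
assert (Hn : 0 < INR (S n)) by (apply lt_0_INR; lia).
assert (HS : B (S n) = / INR (S n)).
{ apply Rmult_eq_reg_l with (INR (S n)); [|lra]. rewrite HBS; field; lra. }
unfold B in HS. rewrite PS_incr_n_simplify in HS.
destruct (Compare_dec.le_lt_dec k (S n)) as [h|h].
- lra.
(* Below k the shifted series has coefficient 0, which agrees with the truncated index because A 0 =
   0. *)
- change (A (S n) - 0 = / INR (S n)) in HS.
  replace (S n - k)%nat with 0%nat by lia. lra.
Qed.

Ltac in_R := match goal with |- @eq _ ?a ?b => change (@eq R a b) end.

(** * Harmonic numbers and bounds on the coefficients *)

Definition harmonic (n : nat) : R := sum_n_m (fun j => / INR j) 1 n.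

Lemma harmonic_S (n : nat) : harmonic (S n) = harmonic n + / INR (S n).
Proof.
unfold harmonic. rewrite sum_n_Sm by lia. reflexivity.
Qed.

Lemma harmonic_0 : harmonic 0 = 0.
Proof. unfold harmonic. rewrite sum_n_m_zero by lia. reflexivity. Qed.

Lemma inv_INR_S_pos (n : nat) : 0 < / INR (S n).
Proof. apply Rinv_0_lt_compat, lt_0_INR; lia. Qed.

Lemma harmonic_incr (m n : nat) : (m <= n)%nat -> harmonic m <= harmonic n.
Proof.
induction 1; [lra|]. rewrite harmonic_S. pose proof (inv_INR_S_pos m0); lra.
Qed.

Section Coefficients.

Variables (k : nat) (A : nat -> R).
Hypothesis hk : (1 <= k)%nat.
Hypothesis A_0 : A 0%nat = 0.
Hypothesis A_S : forall n, A (S n) = A (S n - k)%nat + / INR (S n).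

(** Since k >= 1, unrolling the recurrence collects only some of the terms of the harmonic sum;
    hence strong induction. *)
Lemma A_bounds (n : nat) : 0 <= A n <= harmonic n.
Proof.
induction n as [n IH] using (well_founded_induction Wf_nat.lt_wf).
destruct n as [|n].
- rewrite A_0, harmonic_0; lra.
- rewrite A_S, harmonic_S.
  assert (H := IH (S n - k)%nat ltac:(lia)).
  assert (H1 := harmonic_incr (S n - k) n ltac:(lia)).
  pose proof (inv_INR_S_pos n); lra.
Qed.

(* Truncated subtraction is harmless here because A 0 = 0. *)
Lemma A_window_sum (n : nat) : sum_n (fun r => A (n - r)%nat) (pred k) = harmonic n.
Proof.
induction n as [|n IH].
- rewrite harmonic_0. rewrite (sum_n_ext _ (fun _ => 0)).
  + rewrite sum_n_const; apply Rmult_0_r.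
  + intros r; exact A_0.
- rewrite harmonic_S, <- IH. clear IH.
  destruct k as [|k']; [lia|]. simpl (pred _).
  (* Sliding the window gains A (n+1) and loses A (n-j); at j = k-1 the recurrence evaluates this
     difference as 1/(n+1). *)
  assert (E : forall j, sum_n (fun r => A (S n - r)%nat) j
     = A (S n) - A (n - j)%nat + sum_n (fun r => A (n - r)%nat) j).
  { induction j as [|j IHj].
    - rewrite !sum_O, Nat.sub_0_r. simpl. rewrite Nat.sub_0_r. in_R; ring.
    - rewrite !sum_Sn, IHj. unfold plus; simpl.
      replace (n - j)%nat with (S n - S j)%nat by lia. simpl.
      in_R; ring. }
  rewrite E. rewrite A_S. replace (S n - S k')%nat with (n - k')%nat by lia. in_R; ring.
Qed.

End Coefficients.

(** * Sums against powers of the logarithm *)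

(** Series start at index 0, so n stands for the integer n+1. Its real powers are written as
    exponentials of multiples of [logS n], which turns every estimate into one on y^p exp (- e
    y). *)
Definition logS (n : nat) : R := ln (INR (S n)).

Lemma exp_le_compat (x y : R) : x <= y -> exp x <= exp y.
Proof. intros [H| ->]; [left; now apply exp_increasing | lra]. Qed.

Lemma exp_logS (n : nat) : exp (logS n) = INR (S n).
Proof. apply exp_ln, lt_0_INR; lia. Qed.

Lemma exp_opp_logS (n : nat) : exp (- logS n) = / INR (S n).
Proof. rewrite exp_Ropp, exp_logS; reflexivity. Qed.

Lemma logS_0 : logS 0 = 0.
Proof. exact ln_1. Qed.

Lemma logS_incr (m n : nat) : (m <= n)%nat -> logS m <= logS n.
Proof.
intros H. apply ln_le; [apply lt_0_INR; lia | apply le_INR; lia].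
Qed.

Lemma logS_ge_0 (n : nat) : 0 <= logS n.
Proof. rewrite <- logS_0. apply logS_incr; lia. Qed.

(** Both sides are 1 + x <= exp x, at the difference d of the logarithms and at - d, whose
    exponentials are rational in n. *)
Lemma logS_S_bounds (n : nat) :
  / INR (S (S n)) <= logS (S n) - logS n <= / INR (S n).
Proof.
assert (Hn : 0 < INR (S n)) by (apply lt_0_INR; lia).
assert (E : exp (logS (S n) - logS n) = 1 + / INR (S n)).
{ unfold Rminus. rewrite exp_plus, exp_Ropp, !exp_logS, (S_INR (S n)). field; lra. }
assert (E' : exp (- (logS (S n) - logS n)) = 1 - / INR (S (S n))).
{ rewrite exp_Ropp, E, (S_INR (S n)). field; lra. }
pose proof (exp_ineq1_le (logS (S n) - logS n)).
pose proof (exp_ineq1_le (- (logS (S n) - logS n))). lra.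
Qed.

Lemma is_lim_seq_logS : is_lim_seq logS p_infty.
Proof.
apply (filterlim_comp _ _ _ (fun n => INR (S n)) ln _ (Rbar_locally p_infty)).
- apply (proj1 (is_lim_seq_incr_1 INR p_infty)), is_lim_seq_INR.
- exact is_lim_ln_p.
Qed.

Lemma is_lim_seq_exp_logS (e : R) : 0 < e -> is_lim_seq (fun n => exp (- (e * logS n))) 0.
Proof.
intros He.
apply (filterlim_comp _ _ _ (fun n => - (e * logS n)) exp _ (Rbar_locally m_infty)).
- apply (is_lim_seq_opp (fun n => e * logS n) p_infty).
  apply (is_lim_seq_ext (fun n => logS n * e)); [intros; ring|].
  assert (H := is_lim_seq_mult logS (fun _ => e) p_infty e p_infty is_lim_seq_logS
    (is_lim_seq_const e)).
  apply H. unfold is_Rbar_mult, Rbar_mult'. destruct (Rle_dec 0 e) as [h|h]; [|lra].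
  destruct (Rle_lt_or_eq_dec 0 e h) as [h'|h']; [reflexivity|lra].
- exact is_lim_exp_m.
Qed.

(** For p > 0 put c = p/e: the inequality y <= c exp (y/c) raised to the power p has exp (e y) on
    the right. *)
Lemma pow_le_exp (p : nat) (e : R) : 0 < e ->
  exists C, 0 <= C /\ forall y, 0 <= y -> y ^ p <= C * exp (e * y).
Proof.
intros He. destruct p as [|p].
- exists 1. split; [lra|]. intros y Hy. simpl.
  pose proof (exp_ineq1_le (e * y)). nra.
- pose (c := INR (S p) / e).
  assert (Hp : 0 < INR (S p)) by (apply lt_0_INR; lia).
  assert (Hc : 0 < c) by (apply Rdiv_lt_0_compat; lra).
  exists (c ^ S p). split; [apply pow_le; lra|]. intros y Hy.
  replace (e * y) with (INR (S p) * (y / c)) by (unfold c; field; lra).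
  replace (exp (INR (S p) * (y / c))) with (exp (y / c) ^ S p).
  + rewrite <- Rpow_mult_distr. apply pow_incr. split; [exact Hy|].
    pose proof (exp_ineq1_le (y / c)).
    apply Rle_trans with (c * (y / c)); [right; field; lra|].
    apply Rmult_le_compat_l; lra.
  + generalize (S p); intros q; induction q as [|q IH].
    * simpl. rewrite Rmult_0_l, exp_0; reflexivity.
    * rewrite S_INR, Rmult_plus_distr_r, exp_plus, <- IH, Rmult_1_l. simpl; ring.
Qed.

Lemma ex_series_Rabs_le (a b : nat -> R) :
  (forall n, Rabs (a n) <= b n) -> ex_series b -> ex_series a.
Proof. exact (ex_series_le a b). Qed.

Lemma ex_series_Rmult (c : R) (a : nat -> R) :
  ex_series a -> ex_series (fun n => c * a n).
Proof. exact (ex_series_scal (V := R_NormedModule) c a). Qed.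

(** Domination by a telescoping series: (n^(-e) - (n+1)^(-e))/e is at least (n+1)^(-1-e), by 1 + x
    <= exp x and the lower bound on the step of the logarithm. *)
Lemma ex_series_exp_logS (e : R) : 0 < e ->
  ex_series (fun n => exp (- ((1 + e) * logS n))).
Proof.
intros He.
apply (ex_series_incr_1 (fun n => exp (- ((1 + e) * logS n)))).
assert (Htel : ex_series (fun n => / e * (exp (- (e * logS n)) - exp (- (e * logS (S n)))))).
{ apply (ex_series_Rmult (/ e) (fun n => exp (- (e * logS n)) - exp (- (e * logS (S n))))).
  exists (1 - 0).
  change (is_lim_seq (sum_n (fun n => exp (- (e * logS n)) - exp (- (e * logS (S n))))) (1 - 0)).
  apply is_lim_seq_ext with (fun n => 1 - exp (- (e * logS (S n)))).
  - intros n; induction n as [|n IH].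
    + rewrite sum_O, logS_0, Rmult_0_r, Ropp_0, exp_0; reflexivity.
    + rewrite sum_Sn, <- IH. unfold plus; simpl; ring.
  - apply is_lim_seq_minus'; [apply is_lim_seq_const|].
    apply (is_lim_seq_incr_1 (fun n => exp (- (e * logS n)))), is_lim_seq_exp_logS, He. }
apply (ex_series_Rabs_le _ _) with (2 := Htel); intros n.
rewrite Rabs_pos_eq by (left; apply exp_pos).
pose proof (logS_S_bounds n) as [H _].
apply Rmult_le_reg_l with e; [exact He|].
rewrite <- Rmult_assoc, Rinv_r, Rmult_1_l by lra.
replace (- ((1 + e) * logS (S n))) with (- logS (S n) + - (e * logS (S n))) by ring.
rewrite exp_plus, exp_opp_logS.
replace (- (e * logS n)) with (e * (logS (S n) - logS n) + - (e * logS (S n))) by ring.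
rewrite exp_plus.
pose proof (exp_ineq1_le (e * (logS (S n) - logS n))).
pose proof (exp_pos (- (e * logS (S n)))).
assert (e * / INR (S (S n)) <= e * (logS (S n) - logS n)) by (apply Rmult_le_compat_l; lra).
nra.
Qed.

(** Half of [e] absorbs the power of the logarithm; the other half keeps the series convergent. *)
Lemma ex_series_pow_logS (p : nat) (e : R) : 0 < e ->
  ex_series (fun n => logS n ^ p * exp (- ((1 + e) * logS n))).
Proof.
intros He. destruct (pow_le_exp p (e / 2)) as (C & HC & HCb); [lra|].
assert (H := ex_series_Rmult C _ (ex_series_exp_logS (e / 2) ltac:(lra))).
apply (ex_series_Rabs_le _ _) with (2 := H); intros n.
pose proof (logS_ge_0 n).
rewrite Rabs_pos_eq by (apply Rmult_le_pos; [now apply pow_le | left; apply exp_pos]).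
replace (- ((1 + e / 2) * logS n)) with (e / 2 * logS n + - ((1 + e) * logS n)) by field.
rewrite exp_plus, <- Rmult_assoc.
apply Rmult_le_compat_r; [left; apply exp_pos | now apply HCb].
Qed.

Lemma is_lim_seq_pow_exp_logS (p : nat) (e : R) : 0 < e ->
  is_lim_seq (fun n => logS n ^ p * exp (- (e * logS n))) 0.
Proof.
intros He. destruct (pow_le_exp p (e / 2)) as (C & HC & HCb); [lra|].
apply is_lim_seq_le_le with (fun _ => 0) (fun n => C * exp (- (e / 2 * logS n))).
- intros n. pose proof (logS_ge_0 n). split.
  + apply Rmult_le_pos; [now apply pow_le | left; apply exp_pos].
  + replace (- (e / 2 * logS n)) with (e / 2 * logS n + - (e * logS n)) by field.
    rewrite exp_plus, <- Rmult_assoc.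
    apply Rmult_le_compat_r; [left; apply exp_pos | now apply HCb].
- apply is_lim_seq_const.
- replace (Finite 0) with (Rbar_mult C 0) by (simpl; f_equal; ring).
  apply is_lim_seq_scal_l, is_lim_seq_exp_logS; lra.
Qed.

(** * Comparison of sums with integrals *)

Lemma MVT_le (f df : R -> R) (u v : R) : u <= v ->
  (forall x, u <= x <= v -> is_derive f x (df x)) ->
  exists c, u <= c <= v /\ f v - f u = df c * (v - u).
Proof.
intros Huv Hd.
destruct (MVT_gen f u v df) as (c & Hc & E).
- intros x; rewrite Rmin_left, Rmax_right by exact Huv; intros Hx; apply Hd; lra.
- intros x; rewrite Rmin_left, Rmax_right by exact Huv; intros Hx.
  apply continuity_pt_filterlim, (ex_derive_continuous (V := R_NormedModule)).
  exists (df x); apply Hd; lra.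
- rewrite Rmin_left, Rmax_right in Hc by exact Huv. exists c; tauto.
Qed.

(** The polynomial factor of the derivative costs exp (y/4), hence the exponent 3/4. On a step v - u
    <= 1/n of the logarithm the bound becomes n^(-7/4), still summable. *)
Lemma pow_exp_opp_lipschitz (p : nat) :
  exists C, 0 <= C /\ forall u v, 0 <= u <= v ->
    Rabs (v ^ p * exp (- v) - u ^ p * exp (- u)) <= C * exp (- (3 / 4 * u)) * (v - u).
Proof.
destruct (pow_le_exp (pred p) (1 / 4)) as (C1 & HC1 & H1); [lra|].
destruct (pow_le_exp p (1 / 4)) as (C2 & HC2 & H2); [lra|].
assert (Hp := pos_INR p).
exists (INR p * C1 + C2). split; [nra|]. intros u v [Hu Huv].
destruct (MVT_le (fun y => y ^ p * exp (- y))
  (fun y => (INR p * y ^ pred p - y ^ p) * exp (- y)) u v Huv) as (c & Hc & E).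
{ intros x _. auto_derive; [trivial|ring]. }
rewrite E, Rabs_mult, (Rabs_pos_eq (v - u)) by lra.
apply Rmult_le_compat_r; [lra|].
rewrite Rabs_mult, (Rabs_pos_eq (exp _)) by (left; apply exp_pos).
assert (B : Rabs (INR p * c ^ pred p - c ^ p) <= (INR p * C1 + C2) * exp (1 / 4 * c)).
{ specialize (H1 c ltac:(lra)). specialize (H2 c ltac:(lra)).
  assert (P1 : 0 <= c ^ pred p) by (apply pow_le; lra).
  assert (P2 : 0 <= c ^ p) by (apply pow_le; lra).
  pose proof (exp_pos (1/4 * c)).
  assert (INR p * c ^ pred p <= INR p * (C1 * exp (1 / 4 * c))) by (apply Rmult_le_compat_l; lra).
  assert (0 <= INR p * c ^ pred p) by (apply Rmult_le_pos; lra).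
  assert (0 <= INR p * (C1 * exp (1 / 4 * c)))
    by (apply Rmult_le_pos; [lra|]; apply Rmult_le_pos; lra).
  apply Rabs_le. lra. }
apply Rle_trans with ((INR p * C1 + C2) * exp (1 / 4 * c) * exp (- c)).
- apply Rmult_le_compat_r; [left; apply exp_pos | exact B].
- rewrite Rmult_assoc, <- exp_plus. apply Rmult_le_compat_l; [nra|].
  apply exp_le_compat. lra.
Qed.

Definition log_primitive (p : nat) (y : R) : R := y ^ (p + 1) / INR (p + 1).

Lemma INR_p1_pos (p : nat) : 0 < INR (p + 1).
Proof. apply lt_0_INR; lia. Qed.

Lemma is_derive_log_primitive (p : nat) (y : R) :
  is_derive (log_primitive p) y (y ^ p).
Proof.
pose proof (INR_p1_pos p). unfold log_primitive.
auto_derive; [trivial|]. replace (pred (p + 1)) with p by lia. field; lra.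
Qed.

Lemma log_primitive_incr (p : nat) (u v : R) : 0 <= u <= v ->
  log_primitive p u <= log_primitive p v.
Proof.
intros H. apply Rmult_le_compat_r.
- left; apply Rinv_0_lt_compat, INR_p1_pos.
- now apply pow_incr.
Qed.

(** By the mean value theorem the increment of the primitive is log^p c / c for some c in
    [n+1, n+2]; replacing c by n+1 costs a summable Lipschitz error. *)
Lemma ex_series_log_primitive (p : nat) :
  ex_series (fun n => logS n ^ p * exp (- logS n)
                      - (log_primitive p (logS (S n)) - log_primitive p (logS n))).
Proof.
destruct (pow_exp_opp_lipschitz p) as (C & HC & HL).
apply ex_series_Rabs_le with (fun n => C * exp (- ((1 + 3 / 4) * logS n))).
2: apply ex_series_Rmult, ex_series_exp_logS; lra.
intros n.
pose proof (logS_ge_0 n). pose proof (logS_incr n (S n) ltac:(lia)).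
pose proof (logS_S_bounds n) as [_ Hd]. rewrite <- exp_opp_logS in Hd.
assert (Hn : 0 < INR (S n)) by (apply lt_0_INR; lia).
destruct (MVT_le (fun x => log_primitive p (ln x)) (fun x => ln x ^ p * exp (- ln x))
  (INR (S n)) (INR (S (S n)))) as (c & Hc & E).
{ apply le_INR; lia. }
{ intros x Hx. rewrite exp_Ropp, exp_ln by lra.
  evar_last. apply (is_derive_comp (log_primitive p) ln x).
  apply is_derive_log_primitive. apply is_derive_ln; lra.
  unfold scal; simpl; unfold mult; simpl; ring. }
replace (INR (S (S n)) - INR (S n)) with 1 in E by (rewrite (S_INR (S n)); ring).
fold (logS n) (logS (S n)) in E. rewrite E, Rmult_1_r, <- Rabs_Ropp, Ropp_minus_distr.
assert (Hc1 : logS n <= ln c) by (apply ln_le; lra).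
assert (Hc2 : ln c <= logS (S n)) by (apply ln_le; lra).
eapply Rle_trans; [apply HL; lra|].
replace (- ((1 + 3 / 4) * logS n)) with (- (3 / 4 * logS n) + - logS n) by field.
rewrite exp_plus, <- Rmult_assoc. apply Rmult_le_compat_l; [|lra].
apply Rmult_le_pos; [lra | left; apply exp_pos].
Qed.

(** The increment is log^p n / n minus the general term of a convergent series. It makes the jumps
    of the main term negligible, both in the Abelian theorem and in passing to real x. *)
Lemma is_lim_seq_log_primitive_diff (p : nat) :
  is_lim_seq (fun n => log_primitive p (logS (S n)) - log_primitive p (logS n)) 0.
Proof.
apply is_lim_seq_ext with (fun n => logS n ^ p * exp (- (1 * logS n)) -
  (logS n ^ p * exp (- logS n)
    - (log_primitive p (logS (S n)) - log_primitive p (logS n)))).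
{ intros n; rewrite Rmult_1_l; ring. }
replace (Finite 0) with (Finite (0 - 0)) by (f_equal; ring).
apply is_lim_seq_minus'.
- apply is_lim_seq_pow_exp_logS; lra.
- apply ex_series_lim_0, ex_series_log_primitive.
Qed.

(** * Existence of the limit *)

Lemma harmonic_sub_logS_decr (n : nat) :
  harmonic (S (S n)) - logS (S n) <= harmonic (S n) - logS n.
Proof. rewrite (harmonic_S (S n)). pose proof (logS_S_bounds n); lra. Qed.

Lemma harmonic_1 : harmonic 1 = 1.
Proof. rewrite harmonic_S, harmonic_0. simpl; field. Qed.

Lemma harmonic_le_logS (n : nat) : harmonic (S n) <= 1 + logS n.
Proof.
induction n as [|n IH].
- rewrite harmonic_1, logS_0; lra.
- pose proof (harmonic_sub_logS_decr n); lra.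
Qed.

(** The increasing H_n - log (n+1) and the decreasing H_n - log n enclose gamma, and their gap is at
    most 1/n. *)
Lemma euler_gamma_error (n : nat) :
  Rabs (harmonic (S n) - logS n - euler_gamma) <= exp (- logS n).
Proof.
set (u := fun n => harmonic (S n) - logS (S n)).
set (v := fun n => harmonic (S n) - logS n).
assert (Hu : forall n, u n <= u (S n)).
{ intros i; unfold u. rewrite (harmonic_S (S i)). pose proof (logS_S_bounds (S i)); lra. }
assert (Hv : forall n, v (S n) <= v n) by exact harmonic_sub_logS_decr.
destruct (ex_lim_seq_adj u v Hu Hv) as ([lu Lu] & [lv Lv] & E).
{ apply is_lim_seq_le_le with (fun _ => 0) (fun n => exp (- (1 * logS n))).
  - intros i; unfold u, v. pose proof (logS_incr i (S i) ltac:(lia)).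
    pose proof (logS_S_bounds i). rewrite Rmult_1_l, exp_opp_logS; lra.
  - apply is_lim_seq_const.
  - apply is_lim_seq_exp_logS; lra. }
assert (El : lu = lv).
{ apply is_lim_seq_unique in Lu. apply is_lim_seq_unique in Lv. congruence. }
(* Convergence is what makes [Lim_seq] in the definition a true limit; the shift by one index skips
   its term at n = 0. *)
assert (Eg : euler_gamma = lv).
{ unfold euler_gamma. replace (Lim_seq _) with (Finite lv); [reflexivity|].
  symmetry; apply is_lim_seq_unique, is_lim_seq_incr_1. exact Lv. }
rewrite Eg.
assert (H1 := is_lim_seq_incr_compare u lu Lu Hu n).
assert (H2 := is_lim_seq_decr_compare v lv Lv Hv n).
unfold u, v in *. pose proof (logS_S_bounds n). rewrite exp_opp_logS.
apply Rabs_le; lra.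
Qed.

(** * Summation by parts and the averaged coefficients *)

Lemma ex_series_Rplus (a b : nat -> R) :
  ex_series a -> ex_series b -> ex_series (fun n => a n + b n).
Proof. exact (ex_series_plus a b). Qed.

Lemma ex_series_by_parts (x phi : nat -> R) (l : R) :
  is_lim_seq (fun n => x n * phi n) l ->
  ex_series (fun n => x n * (phi (S n) - phi n)) ->
  ex_series (fun n => (x (S n) - x n) * phi (S n)).
Proof.
intros Hl [s Hs]. exists (l - x 0%nat * phi 0%nat - s).
change (is_lim_seq (sum_n (fun n => (x (S n) - x n) * phi (S n)))
          (l - x 0%nat * phi 0%nat - s)).
apply is_lim_seq_ext with (fun n => x (S n) * phi (S n) - x 0%nat * phi 0%nat
  - sum_n (fun n => x n * (phi (S n) - phi n)) n).
- induction n as [|n IH].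
  + rewrite !sum_O. ring.
  + rewrite !sum_Sn, <- IH. unfold plus; simpl. ring.
- apply is_lim_seq_minus'; [|exact Hs].
  apply is_lim_seq_minus'; [|apply is_lim_seq_const].
  now apply (is_lim_seq_incr_1 (fun n => x n * phi n)).
Qed.

(** Summation by parts moves the difference from the irregular x to the smooth weight, whose
    increments are O(n^(-7/4)); logarithmic growth of x is then harmless. *)
Lemma ex_series_shift_diff (m : nat) (x : nat -> R) :
  (forall n, Rabs (x n) <= 1 + logS n) ->
  ex_series (fun n => (x (S n) - x n) * (logS (S n) ^ m * exp (- logS (S n)))).
Proof.
intros Hx. set (phi := fun n => logS n ^ m * exp (- logS n)).
apply (ex_series_by_parts x phi 0).
- apply is_lim_seq_abs_0.
  apply is_lim_seq_le_le with (fun _ => 0)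
    (fun n => logS n ^ m * exp (- (1 * logS n)) + logS n ^ S m * exp (- (1 * logS n))).
  + intros n. split; [apply Rabs_pos|]. unfold phi.
    pose proof (logS_ge_0 n).
    rewrite Rabs_mult, Rmult_1_l.
    assert (0 <= logS n ^ m * exp (- logS n))
      by (apply Rmult_le_pos; [now apply pow_le | left; apply exp_pos]).
    rewrite (Rabs_pos_eq (_ * _)) by assumption. specialize (Hx n). simpl. nra.
  + apply is_lim_seq_const.
  + replace (Finite 0) with (Finite (0 + 0)) by (f_equal; ring).
    apply is_lim_seq_plus'; apply is_lim_seq_pow_exp_logS; lra.
- destruct (pow_exp_opp_lipschitz m) as (C & HC & HL).
  apply ex_series_Rabs_le with (fun n => C * (logS n ^ 0 * exp (- ((1 + 3 / 4) * logS n))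
    + logS n ^ 1 * exp (- ((1 + 3 / 4) * logS n)))).
  + intros n. pose proof (logS_ge_0 n). pose proof (logS_incr n (S n) ltac:(lia)).
    pose proof (logS_S_bounds n) as [_ Hd]. rewrite <- exp_opp_logS in Hd.
    rewrite Rabs_mult.
    apply Rle_trans with ((1 + logS n) * (C * exp (- (3 / 4 * logS n)) * (exp (- logS n)))).
    * apply Rmult_le_compat; try apply Rabs_pos; [apply Hx|].
      eapply Rle_trans; [apply HL; lra|].
      apply Rmult_le_compat_l; [|lra].
      apply Rmult_le_pos; [lra | left; apply exp_pos].
    * replace (- ((1 + 3 / 4) * logS n)) with (- (3 / 4 * logS n) + - logS n) by field.
      rewrite exp_plus. right; ring.
  + apply ex_series_Rmult, ex_series_Rplus; apply ex_series_pow_logS; lra.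
Qed.

Section Asymptotics.

Variables (k : nat) (A : nat -> R).
Hypothesis hk : (1 <= k)%nat.
Hypothesis A_0 : A 0%nat = 0.
Hypothesis A_S : forall n, A (S n) = A (S n - k)%nat + / INR (S n).

Lemma A_le_logS (n : nat) : 0 <= A (S n) <= 1 + logS n.
Proof.
pose proof (A_bounds k A hk A_0 A_S (S n)). pose proof (harmonic_le_logS n). lra.
Qed.

(** A shift by r is r unit shifts, each a case of [ex_series_shift_diff] once the first term is
    dropped. *)
Lemma ex_series_A_shift (m r : nat) :
  ex_series (fun n => (A (S n) - A (S n - r)%nat) * (logS n ^ m * exp (- logS n))).
Proof.
induction r as [|r IH].
- apply ex_series_ext with (fun _ => 0 * 0).
  + intros n. rewrite Nat.sub_0_r. in_R; ring.
  + apply ex_series_Rmult. exists 0.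
    change (is_lim_seq (sum_n (fun _ => 0)) 0).
    apply is_lim_seq_ext with (fun _ => 0); [|apply is_lim_seq_const].
    intros n; rewrite sum_n_const. in_R; ring.
- apply ex_series_ext with (fun n =>
    (A (S n) - A (S n - r)%nat) * (logS n ^ m * exp (- logS n)) +
    (A (S n - r)%nat - A (n - r)%nat) * (logS n ^ m * exp (- logS n))).
  { intros n. simpl (S n - S r)%nat. in_R; ring. }
  apply ex_series_Rplus; [exact IH|].
  apply (ex_series_incr_1 (fun n =>
    (A (S n - r)%nat - A (n - r)%nat) * (logS n ^ m * exp (- logS n)))).
  apply (ex_series_shift_diff m (fun n => A (S n - r)%nat)).
  intros n. destruct (A_bounds k A hk A_0 A_S (S n - r)) as [H1 H2].
  rewrite Rabs_pos_eq by exact H1.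
  pose proof (harmonic_incr (S n - r) (S n) ltac:(lia)).
  pose proof (harmonic_le_logS n). lra.
Qed.

Lemma ex_series_A_harmonic (m : nat) :
  ex_series (fun n => (INR k * A (S n) - harmonic (S n)) * (logS n ^ m * exp (- logS n))).
Proof.
apply ex_series_ext with (fun n =>
  sum_n (fun r => A (S n) - A (S n - r)%nat) (pred k) * (logS n ^ m * exp (- logS n))).
(* As H_n is the sum of the k values A (n-r), k A n - H_n is the sum over r < k of A n - A (n-r). *)
{ intros n. f_equal. rewrite <- (A_window_sum k A hk A_0 A_S).
  replace (INR k) with (INR (S (pred k))) by (f_equal; lia).
  generalize (pred k); intros j; induction j as [|j IH].
  - rewrite !sum_O. simpl. in_R; ring.
  - rewrite !sum_Sn, IH, (S_INR (S j)). unfold plus; simpl (AbelianMonoid.plus _ _).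
    simpl. in_R; ring. }
generalize (pred k); intros j; induction j as [|j IH].
- apply ex_series_ext with (2 := ex_series_A_shift m 0).
  intros n; rewrite sum_O; reflexivity.
- apply ex_series_ext with (2 := ex_series_Rplus _ _ IH (ex_series_A_shift m (S j))).
  intros n. rewrite sum_Sn. unfold plus; simpl. in_R; ring.
Qed.

(** The terms subtracted in the theorem, in the variable y = log x; [log_primitive p] has degree
    p+1. *)
Definition main_term (m : nat) (y : R) : R :=
  / INR k * log_primitive (m + 1) y + euler_gamma / INR k * log_primitive m y.

Lemma ex_series_A_main_term (m : nat) :
  ex_series (fun n => A (S n) * logS n ^ m * exp (- logS n)
                      - (main_term m (logS (S n)) - main_term m (logS n))).
Proof.
assert (Hk : 0 < INR k) by (apply lt_0_INR; lia).
set (phi := fun n => logS n ^ m * exp (- logS n)).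
set (d := fun p n => log_primitive p (logS (S n)) - log_primitive p (logS n)).
(* Three separately summable errors: k A n against H_n, H_n against log n + gamma, and the sums of
   log^p n / n, p = m+1 and m, against integrals. *)
apply ex_series_ext with (fun n =>
  / INR k * ((INR k * A (S n) - harmonic (S n)) * phi n
   + ((harmonic (S n) - logS n - euler_gamma) * phi n
   + ((logS n ^ (m + 1) * exp (- logS n) - d (m + 1)%nat n)
   + euler_gamma * (logS n ^ m * exp (- logS n) - d m n))))).
{ intros n. unfold phi, d, main_term. rewrite pow_add, pow_1. in_R; field; lra. }
apply ex_series_Rmult, ex_series_Rplus; [apply ex_series_A_harmonic|].
apply ex_series_Rplus.
- apply ex_series_Rabs_le with (2 := ex_series_pow_logS m 1 Rlt_0_1).
  intros n. unfold phi. pose proof (logS_ge_0 n).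
  assert (0 <= logS n ^ m * exp (- logS n))
    by (apply Rmult_le_pos; [now apply pow_le | left; apply exp_pos]).
  rewrite Rabs_mult, (Rabs_pos_eq (_ * _)) by assumption.
  replace (- ((1 + 1) * logS n)) with (- logS n + - logS n) by ring.
  rewrite exp_plus. pose proof (euler_gamma_error n). nra.
- apply ex_series_Rplus; [|apply ex_series_Rmult]; apply ex_series_log_primitive.
Qed.

End Asymptotics.

(** * An Abelian theorem *)

Definition abel_weight (t : R) (n : nat) : R :=
  exp (- (t * logS n)) - exp (- (t * logS (S n))).

Lemma exp_opp_logS_decr (t : R) (m n : nat) : 0 <= t -> (m <= n)%nat ->
  exp (- (t * logS n)) <= exp (- (t * logS m)).
Proof.
intros Ht H. apply exp_le_compat, Ropp_le_contravar, Rmult_le_compat_l;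
  [exact Ht | now apply logS_incr].
Qed.

Lemma abel_weight_ge_0 (t : R) (n : nat) : 0 <= t -> 0 <= abel_weight t n.
Proof.
intros Ht. pose proof (exp_opp_logS_decr t n (S n) Ht ltac:(lia)).
unfold abel_weight; lra.
Qed.

(** Weights before a fixed N0 have total mass at most t log (N0+1), which vanishes with t; beyond N0
    the sequence is below eps/2 and the mass is at most 1. *)
Lemma abel_weight_sum_small (x : nat -> R) :
  is_lim_seq x 0 -> forall eps, 0 < eps -> exists delta, 0 < delta /\
  forall t, 0 < t < delta -> forall N, sum_n (fun n => x n * abel_weight t n) N <= eps.
Proof.
intros Hx eps Heps.
destruct (filterlim_bounded x (ex_intro _ 0 Hx)) as [B HB].
change (forall n, Rabs (x n) <= B) in HB.
assert (HB0 : 0 <= B) by (eapply Rle_trans; [apply Rabs_pos | apply (HB 0%nat)]).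
apply is_lim_seq_spec in Hx.
destruct (Hx (mkposreal (eps / 2) ltac:(lra))) as [N0 HN0]. simpl in HN0.
pose proof (logS_ge_0 N0) as Hl.
assert (Hden : 0 < B * logS N0 + 1) by nra.
(* The added 1 keeps the denominator positive when B or [logS N0] is 0. *)
exists (eps / 2 / (B * logS N0 + 1)). split; [apply Rdiv_lt_0_compat; lra|].
intros t [Ht Htd] N.
assert (Hsmall : B * (1 - exp (- (t * logS N0))) <= eps / 2).
{ pose proof (exp_ineq1_le (- (t * logS N0))).
  apply Rle_trans with (B * (t * logS N0)); [apply Rmult_le_compat_l; lra|].
  apply (Rmult_lt_compat_r (B * logS N0 + 1)) in Htd; [|exact Hden].
  replace (eps / 2 / (B * logS N0 + 1) * (B * logS N0 + 1)) with (eps / 2) in Htd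
    by (field; lra). nra. }
(* [e (Nat.min n N0)] stops moving at N0, so a single telescoping bound covers both ranges. *)
set (e := fun n => exp (- (t * logS n))).
assert (Hsum : forall N, sum_n (fun n => x n * abel_weight t n) N
  <= B * (1 - e (Nat.min (S N) N0)) + eps / 2 * (1 - e (S N))).
{ assert (Hterm : forall n, x n * abel_weight t n
    <= B * (e (Nat.min n N0) - e (Nat.min (S n) N0)) + eps / 2 * (e n - e (S n))).
  { intros n. pose proof (abel_weight_ge_0 t n ltac:(lra)) as Hw.
    change (e n - e (S n)) with (abel_weight t n).
    destruct (Nat.le_gt_cases N0 n) as [h|h].
    - rewrite !Nat.min_r by lia. specialize (HN0 n h). rewrite Rminus_0_r in HN0.
      apply Rabs_def2 in HN0. nra.
    - rewrite !Nat.min_l by lia. change (e n - e (S n)) with (abel_weight t n).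
      pose proof (Rle_trans _ _ _ (Rle_abs (x n)) (HB n)). nra. }
  assert (He0 : e 0%nat = 1)
    by (unfold e; rewrite logS_0, Rmult_0_r, Ropp_0, exp_0; reflexivity).
  induction N1 as [|N1 IH].
  - rewrite sum_O. specialize (Hterm 0%nat). simpl (Nat.min 0 N0) in Hterm.
    rewrite He0 in Hterm. exact Hterm.
  - rewrite sum_Sn. unfold plus; simpl (AbelianMonoid.plus _ _).
    specialize (Hterm (S N1)). cbn -[e Nat.min abel_weight].
    cbn -[e Nat.min abel_weight] in IH. lra. }
eapply Rle_trans; [apply Hsum|].
assert (H1 : e N0 <= e (Nat.min (S N) N0)) by (apply exp_opp_logS_decr; [lra|lia]).
pose proof (exp_pos (- (t * logS (S N)))) as H2. fold (e (S N)) in H2.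
fold (e N0) in Hsmall. nra.
Qed.

(** Phi (y) is minus the integral of z^p exp (- t z) over z > y, built by repeated integration by
    parts so that no improper integral appears. *)
Lemma Laplace_primitive (t : R) (p : nat) : 0 < t ->
  exists Phi : R -> R,
    (forall y, is_derive Phi y (y ^ p * exp (- (t * y)))) /\
    Phi 0 = - (INR (fact p) / t ^ (p + 1)) /\
    is_lim_seq (fun n => Phi (logS n)) 0.
Proof.
intros Ht. induction p as [|p (Phi & Hd & H0 & Hlim)].
- exists (fun y => - / t * exp (- (t * y))). split; [|split].
  + intros y. auto_derive; [trivial|]. field; lra.
  + rewrite Rmult_0_r, Ropp_0, exp_0. simpl. field; lra.
  + replace (Finite 0) with (Rbar_mult (- / t) 0) by (simpl; f_equal; ring).
    apply is_lim_seq_scal_l. now apply is_lim_seq_exp_logS.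
- exists (fun y => - / t * (y ^ S p * exp (- (t * y))) + INR (S p) / t * Phi y). split; [|split].
  + intros y. evar_last.
    * apply (is_derive_plus (fun y => - / t * (y ^ S p * exp (- (t * y))))
        (fun y => INR (S p) / t * Phi y)).
      -- auto_derive; [trivial|reflexivity].
      -- apply (is_derive_scal Phi y (INR (S p) / t)), Hd.
    * unfold plus; simpl (AbelianMonoid.plus _ _); cbn -[INR pow].
      change (y ^ S p) with (y * y ^ p). in_R.
      change (match p with 0%nat => 1 | S _ => INR p + 1 end) with (INR (S p)).
      field; lra.
  + rewrite H0, fact_simpl, mult_INR.
    replace (S p + 1)%nat with (S (p + 1)) by lia. simpl (0 ^ S p). simpl (t ^ S _).
    assert (t ^ (p + 1) <> 0) by (apply pow_nonzero; lra). field; lra.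
  + replace (Finite 0) with (Finite (- / t * 0 + INR (S p) / t * 0)) by (f_equal; ring).
    apply is_lim_seq_plus'.
    * apply (is_lim_seq_scal_l _ (- / t) 0). now apply is_lim_seq_pow_exp_logS.
    * apply (is_lim_seq_scal_l _ (INR (S p) / t) 0). exact Hlim.
Qed.

(** With c = exp (- t u) the function c * [log_primitive p] - Phi increases on [u, v], and with c =
    exp (- t v) it decreases; the two facts enclose the error. *)
Lemma Laplace_primitive_error (t : R) (p : nat) (Phi : R -> R) (u v : R) : 0 < t ->
  (forall y, is_derive Phi y (y ^ p * exp (- (t * y)))) -> 0 <= u <= v ->
  Rabs ((log_primitive p v - log_primitive p u) * exp (- (t * u)) - (Phi v - Phi u))
  <= (log_primitive p v - log_primitive p u) * (exp (- (t * u)) - exp (- (t * v))).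
Proof.
intros Ht Hd [Hu Huv].
assert (Hf : forall c, exists z, u <= z <= v /\
   (c * log_primitive p v - Phi v) - (c * log_primitive p u - Phi u)
   = z ^ p * (c - exp (- (t * z))) * (v - u)).
{ intros c.
  apply (MVT_le (fun y => c * log_primitive p y - Phi y)
    (fun y => y ^ p * (c - exp (- (t * y))))); [exact Huv|].
  intros y _. evar_last.
  - apply (is_derive_minus (fun y => c * log_primitive p y) Phi); [|apply Hd].
    apply (is_derive_scal _ y c), is_derive_log_primitive.
  - unfold minus, plus, opp; simpl. ring. }
assert (Hmono : forall a b, a <= b -> exp (- (t * b)) <= exp (- (t * a))).
{ intros a b Hab. apply exp_le_compat. nra. }
destruct (Hf (exp (- (t * u)))) as (z1 & Hz1 & E1).
destruct (Hf (exp (- (t * v)))) as (z2 & Hz2 & E2).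
assert (0 <= z1 ^ p * (exp (- (t * u)) - exp (- (t * z1))) * (v - u)).
{ specialize (Hmono u z1 ltac:(lra)).
  apply Rmult_le_pos; [apply Rmult_le_pos; [apply pow_le|]|]; lra. }
assert (0 <= z2 ^ p * (exp (- (t * z2)) - exp (- (t * v))) * (v - u)).
{ specialize (Hmono z2 v ltac:(lra)).
  apply Rmult_le_pos; [apply Rmult_le_pos; [apply pow_le|]|]; lra. }
apply Rabs_le; lra.
Qed.

(** A bound for the oscillation of the main term between log (n+1) and log (n+2); the absolute
    values make it valid for either sign of [euler_gamma]. *)
Definition main_gap (k m n : nat) : R :=
  Rabs (/ INR k) * (log_primitive (m + 1) (logS (S n)) - log_primitive (m + 1) (logS n))
  + Rabs (euler_gamma / INR k) * (log_primitive m (logS (S n)) - log_primitive m (logS n)).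

Lemma is_lim_seq_main_gap (k m : nat) (u : nat -> R) (L : R) : is_lim_seq u L ->
  is_lim_seq (fun n => Rabs (u n - L) + main_gap k m n) 0.
Proof.
intros Hu.
replace (Finite 0) with (Finite (0 + (Rabs (/ INR k) * 0 + Rabs (euler_gamma / INR k) * 0)))
  by (f_equal; ring).
apply is_lim_seq_plus'; [|apply is_lim_seq_plus'].
- apply (is_lim_seq_abs_0 (fun n => u n - L)).
  replace (Finite 0) with (Finite (L - L)) by (f_equal; ring).
  apply is_lim_seq_minus'; [exact Hu | apply is_lim_seq_const].
- apply (is_lim_seq_scal_l _ (Rabs _) 0), is_lim_seq_log_primitive_diff.
- apply (is_lim_seq_scal_l _ (Rabs _) 0), is_lim_seq_log_primitive_diff.
Qed.

(* Summation by parts turns the Dirichlet series into an average of the partial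
   sums against the weights [abel_weight t], of total mass 1; since the jumps of
   the main term tend to 0, comparing sum and Laplace integral costs only another
   such average of a null sequence. *)
Lemma abel_limit (k m : nat) (b : nat -> R) (L : R) :
  is_series (fun n => b n - (main_term k m (logS (S n)) - main_term k m (logS n))) L ->
  (forall t, 0 < t -> ex_series (fun n => b n * exp (- (t * logS n)))) ->
  forall eps, 0 < eps -> exists delta, 0 < delta /\ forall t, 0 < t < delta ->
    Rabs (Series (fun n => b n * exp (- (t * logS n)))
          - / INR k * (INR (fact (m + 1)) / t ^ (m + 2))
          - euler_gamma / INR k * (INR (fact m) / t ^ (m + 1)) - L) <= eps.
Proof.
intros HL Hconv eps Heps.
set (c2 := / INR k). set (c1 := euler_gamma / INR k).
set (M := fun n => main_term k m (logS n)).
set (c := fun n => b n - (M (S n) - M n)).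
change (is_lim_seq (sum_n c) L) in HL.
set (d := fun p n => log_primitive p (logS (S n)) - log_primitive p (logS n)).
set (x := fun n => Rabs (sum_n c n - L) + main_gap k m n).
assert (Hx : is_lim_seq x 0) by exact (is_lim_seq_main_gap k m _ L HL).
destruct (abel_weight_sum_small x Hx eps Heps) as (delta & Hdelta & Hsmall).
exists delta. split; [exact Hdelta|]. intros t Ht. specialize (Hsmall t Ht).
destruct (Laplace_primitive t (m + 1)) as (P2 & D2 & Z2 & L2); [lra|].
destruct (Laplace_primitive t m) as (P1 & D1 & Z1 & L1); [lra|].
set (e := fun n => exp (- (t * logS n))).
set (Phi := fun n => c2 * P2 (logS n) + c1 * P1 (logS n)).
assert (Hstep : forall n,
  Rabs ((M (S n) - M n) * e n - (Phi (S n) - Phi n) + (sum_n c n - L) * abel_weight t n)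
  <= x n * abel_weight t n).
{ intros n. pose proof (logS_ge_0 n). pose proof (logS_incr n (S n) ltac:(lia)).
  pose proof (Laplace_primitive_error t _ P2 (logS n) (logS (S n)) ltac:(lra) D2 ltac:(lra)) as E2.
  pose proof (Laplace_primitive_error t _ P1 (logS n) (logS (S n)) ltac:(lra) D1 ltac:(lra)) as E1.
  fold (d (m + 1)%nat n) (e n) (abel_weight t n) in E2. fold (d m n) (e n) (abel_weight t n) in E1.
  pose proof (abel_weight_ge_0 t n ltac:(lra)) as Hw.
  replace ((M (S n) - M n) * e n - (Phi (S n) - Phi n) + (sum_n c n - L) * abel_weight t n)
    with ((sum_n c n - L) * abel_weight t n
      + (c2 * (d (m + 1)%nat n * e n - (P2 (logS (S n)) - P2 (logS n)))
       + c1 * (d m n * e n - (P1 (logS (S n)) - P1 (logS n)))))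
    by (unfold M, Phi, main_term, d, c2, c1; ring).
  eapply Rle_trans; [apply Rabs_triang|].
  unfold x. change (main_gap k m n) with (Rabs c2 * d (m + 1)%nat n + Rabs c1 * d m n).
  rewrite Rmult_plus_distr_r. apply Rplus_le_compat.
  { rewrite Rabs_mult, (Rabs_pos_eq (abel_weight t n)) by exact Hw. lra. }
  eapply Rle_trans; [apply Rabs_triang|].
  rewrite Rmult_plus_distr_r, !Rabs_mult, !Rmult_assoc.
  apply Rplus_le_compat; apply Rmult_le_compat_l; try apply Rabs_pos; assumption. }
(* The last term is the boundary term of the summation by parts. With it, and since the weights up
   to N have mass 1 - e (N+1), the increments of [Q] are exactly the quantities bounded in
   [Hstep]. *)
set (Q := fun N => sum_n (fun n => b n * e n) N - (Phi (S N) - Phi 0%nat) - L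
   - (sum_n c N - L) * e (S N)).
assert (He0 : e 0%nat = 1)
  by (unfold e; rewrite logS_0, Rmult_0_r, Ropp_0, exp_0; reflexivity).
assert (HQ : forall N, Rabs (Q N) <= sum_n (fun n => x n * abel_weight t n) N).
{ induction N as [|N IH].
  - replace (Q 0%nat) with ((M 1%nat - M 0%nat) * e 0%nat - (Phi 1%nat - Phi 0%nat)
      + (sum_n c 0 - L) * abel_weight t 0).
    + rewrite (sum_O (fun n => x n * _)). apply Hstep.
    + unfold Q. rewrite !sum_O. unfold c, abel_weight. fold (e 0%nat) (e 1%nat).
      rewrite He0. ring.
  - replace (Q (S N)) with (Q N + ((M (S (S N)) - M (S N)) * e (S N)
      - (Phi (S (S N)) - Phi (S N)) + (sum_n c (S N) - L) * abel_weight t (S N))).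
    + rewrite (sum_Sn (fun n => x n * _)).
      eapply Rle_trans; [apply Rabs_triang|].
      apply Rplus_le_compat; [exact IH | apply Hstep].
    + unfold Q, abel_weight. fold (e (S N)) (e (S (S N))).
      assert (Ec : sum_n c (S N) = sum_n c N + (b (S N) - (M (S (S N)) - M (S N))))
        by (rewrite sum_Sn; reflexivity).
      assert (Eb : sum_n (fun n => b n * e n) (S N)
                   = sum_n (fun n => b n * e n) N + b (S N) * e (S N))
        by (rewrite sum_Sn; reflexivity).
      rewrite Ec, Eb. ring. }
set (F := Series (fun n => b n * e n)).
(* The boundary term and Phi at infinity vanish; what survives is Phi at 0, which is minus the
   principal part at t. *)
assert (HQlim : is_lim_seq Q (F - (0 - Phi 0%nat) - L - (L - L) * 0)).
{ assert (Hse : is_lim_seq (fun n => e (S n)) 0).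
  { apply (is_lim_seq_incr_1 e), is_lim_seq_exp_logS; lra. }
  apply is_lim_seq_minus'; [apply is_lim_seq_minus'; [apply is_lim_seq_minus'|]|].
  - apply (Series_correct (fun n => b n * e n)), Hconv; lra.
  - apply is_lim_seq_minus'; [|apply is_lim_seq_const].
    apply (is_lim_seq_incr_1 Phi). unfold Phi.
    replace (Finite 0) with (Finite (c2 * 0 + c1 * 0)) by (f_equal; ring).
    apply is_lim_seq_plus'.
    + apply (is_lim_seq_scal_l _ c2 0), L2.
    + apply (is_lim_seq_scal_l _ c1 0), L1.
  - apply is_lim_seq_const.
  - apply is_lim_seq_mult'; [|exact Hse].
    apply is_lim_seq_minus'; [exact HL | apply is_lim_seq_const]. }
assert (Hfin : Rbar_le (Rabs (F - (0 - Phi 0%nat) - L - (L - L) * 0)) eps).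
{ apply is_lim_seq_le with (fun N => Rabs (Q N)) (fun _ => eps).
  - intros N. eapply Rle_trans; [apply HQ | apply Hsmall].
  - apply (is_lim_seq_abs Q (Finite _)), HQlim.
  - apply is_lim_seq_const. }
simpl in Hfin.
change (Series (fun n => b n * exp (- (t * logS n)))) with F.
replace (F - c2 * (INR (fact (m + 1)) / t ^ (m + 2)) - c1 * (INR (fact m) / t ^ (m + 1)) - L)
  with (F - (0 - Phi 0%nat) - L - (L - L) * 0); [exact Hfin|].
unfold Phi. rewrite logS_0, Z2, Z1. replace (m + 1 + 1)%nat with (m + 2)%nat by lia. ring.
Qed.

(** * Derivatives of the Dirichlet series and of the power series *)

(** A summable second-order remainder bounds the error of the difference quotient by |h| times the
    sum of K. *)
Lemma is_derive_Series_quadratic (f : nat -> R -> R) (df K : nat -> R) (t delta : R) :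
  0 < delta ->
  (forall u, Rabs (u - t) < delta -> ex_series (fun n => f n u)) ->
  ex_series df -> ex_series K ->
  (forall n u, Rabs (u - t) < delta ->
     Rabs (f n u - f n t - (u - t) * df n) <= K n * (u - t) ^ 2) ->
  is_derive (fun u => Series (fun n => f n u)) t (Series df).
Proof.
intros Hdelta Hf Hdf HK Hb.
apply is_derive_Reals. intros eps Heps.
assert (Ht : ex_series (fun n => f n t))
  by (apply Hf; rewrite Rminus_diag_eq, Rabs_R0 by reflexivity; exact Hdelta).
(* Nonnegativity of each K n is read off the remainder bound at u = t + delta/2. *)
assert (HS0 : 0 <= Series K).
{ apply Rle_trans with (Series (fun n => 0 * K n)).
  - rewrite Series_scal_l; lra.
  - apply Series_le; [|exact HK]. intros n. split; [lra|].
    assert (Hu : Rabs (t + delta / 2 - t) < delta)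
      by (replace (t + delta / 2 - t) with (delta / 2) by ring; rewrite Rabs_pos_eq; lra).
    pose proof (Rle_trans _ _ _ (Rabs_pos _) (Hb n _ Hu)) as H.
    replace (t + delta / 2 - t) with (delta / 2) in H by ring.
    assert (0 < (delta / 2) ^ 2) by (apply pow_lt; lra). nra. }
assert (Hd : 0 < Rmin delta (eps / (Series K + 1)))
  by (apply Rmin_pos; [lra | apply Rdiv_lt_0_compat; lra]).
exists (mkposreal _ Hd). simpl. intros h Hh Hhd.
assert (Hh1 : Rabs (t + h - t) < delta).
{ replace (t + h - t) with h by ring. eapply Rlt_le_trans; [exact Hhd | apply Rmin_l]. }
assert (Hh2 : Rabs h < eps / (Series K + 1))
  by (eapply Rlt_le_trans; [exact Hhd | apply Rmin_r]).
assert (Hmain : Rabs (Series (fun n => f n (t + h)) - Series (fun n => f n t) - h * Series df)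
                <= Series K * h ^ 2).
{ assert (HKh : ex_series (fun n => h ^ 2 * K n)) by (apply ex_series_Rmult, HK).
  assert (Hb' : forall n, Rabs (f n (t + h) - f n t - h * df n) <= h ^ 2 * K n).
  { intros n. specialize (Hb n _ Hh1). replace (t + h - t) with h in Hb by ring. lra. }
  assert (Habs : ex_series (fun n => Rabs (f n (t + h) - f n t - h * df n))).
  { apply ex_series_Rabs_le with (2 := HKh). intros n. rewrite Rabs_Rabsolu. apply Hb'. }
  assert (H1 : ex_series (fun n => f n (t + h) - f n t)).
  { apply (ex_series_minus (V := R_NormedModule) (fun n => f n (t + h)) (fun n => f n t));
      [apply Hf, Hh1 | exact Ht]. }
  rewrite <- Series_scal_l, <- Series_minus; [|apply Hf, Hh1 | exact Ht].
  rewrite <- Series_minus; [|exact H1 | apply ex_series_Rmult, Hdf].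
  eapply Rle_trans; [apply Series_Rabs, Habs|].
  rewrite (Rmult_comm (Series K)), <- Series_scal_l.
  apply Series_le; [|exact HKh]. intros n. split; [apply Rabs_pos | apply Hb']. }
replace ((Series (fun n => f n (t + h)) - Series (fun n => f n t)) / h - Series df)
  with ((Series (fun n => f n (t + h)) - Series (fun n => f n t) - h * Series df) / h)
  by (field; exact Hh).
assert (Hah : 0 < Rabs h) by now apply Rabs_pos_lt.
unfold Rdiv. rewrite Rabs_mult, Rabs_inv.
apply (Rmult_lt_reg_r (Rabs h)); [exact Hah|].
rewrite Rmult_assoc, Rinv_l, Rmult_1_r by lra.
eapply Rle_lt_trans; [exact Hmain|].
rewrite <- (pow2_abs h).
apply (Rmult_lt_compat_r (Series K + 1)) in Hh2; [|lra].
replace (eps / (Series K + 1) * (Series K + 1)) with eps in Hh2 by (field; lra). nra.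
Qed.

Lemma exp_taylor_1 (x : R) : Rabs (exp x - 1 - x) <= x ^ 2 * exp (Rabs x).
Proof.
assert (H0 := exp_ineq1_le x). rewrite Rabs_pos_eq by lra.
assert (H1 := exp_ineq1_le (- x)). rewrite exp_Ropp in H1.
assert (Hp := exp_pos x).
assert (Hi : exp x * / exp x = 1) by (field; lra).
assert (H2 : exp x - 1 <= x * exp x).
{ apply (Rmult_le_compat_l (exp x)) in H1; lra. }
destruct (Rle_lt_dec 0 x) as [h|h].
- rewrite Rabs_pos_eq by exact h. nra.
- rewrite Rabs_left by exact h.
  pose proof (exp_ineq1_le (- x)). nra.
Qed.

Section DirichletSeries.

Variables (A : nat -> R).
Hypothesis A_le : forall n, 0 <= A (S n) <= 1 + logS n.

(** The factor 1/n sits in the coefficient, so the Dirichlet variable is t = s - 1. *)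
Definition log_coeff (m n : nat) : R := A (S n) * logS n ^ m * exp (- logS n).

Definition log_Dirichlet (m : nat) (t : R) : R :=
  Series (fun n => log_coeff m n * exp (- (t * logS n))).

Lemma log_coeff_ge_0 (m n : nat) : 0 <= log_coeff m n.
Proof.
apply Rmult_le_pos; [|left; apply exp_pos].
apply Rmult_le_pos; [apply A_le | apply pow_le, logS_ge_0].
Qed.

Lemma log_coeff_S (m n : nat) : log_coeff (S m) n = log_coeff m n * logS n.
Proof. unfold log_coeff; simpl; ring. Qed.

Lemma ex_series_log_Dirichlet (m : nat) (t : R) : 0 < t ->
  ex_series (fun n => log_coeff m n * exp (- (t * logS n))).
Proof.
intros Ht.
apply ex_series_Rabs_le with (fun n => logS n ^ m * exp (- ((1 + t) * logS n))
  + logS n ^ S m * exp (- ((1 + t) * logS n))).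
- intros n. rewrite Rabs_pos_eq
    by (apply Rmult_le_pos; [apply log_coeff_ge_0 | left; apply exp_pos]).
  unfold log_coeff.
  replace (- ((1 + t) * logS n)) with (- logS n + - (t * logS n)) by ring.
  rewrite exp_plus, Rmult_assoc.
  assert (0 <= exp (- logS n) * exp (- (t * logS n)))
    by (apply Rmult_le_pos; left; apply exp_pos).
  assert (0 <= logS n ^ m) by apply pow_le, logS_ge_0.
  destruct (A_le n) as [_ HA].
  apply (Rmult_le_compat_r (logS n ^ m * (exp (- logS n) * exp (- (t * logS n))))) in HA.
  + simpl. lra.
  + now apply Rmult_le_pos.
- apply ex_series_Rplus; now apply ex_series_pow_logS.
Qed.

Lemma is_derive_log_Dirichlet (m : nat) (t : R) : 0 < t ->
  is_derive (log_Dirichlet m) t (- log_Dirichlet (S m) t).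
Proof.
intros Ht.
replace (- log_Dirichlet (S m) t)
  with (Series (fun n => -1 * (log_coeff (S m) n * exp (- (t * logS n)))))
  by (rewrite Series_scal_l; unfold log_Dirichlet; ring).
(* For |u - t| < t/2 the factor exp |x| of the Taylor remainder is at most exp (t/2 * log n),
   leaving half the decay; x^2 brings two more logarithms. *)
apply is_derive_Series_quadratic with
  (K := fun n => log_coeff (S (S m)) n * exp (- (t / 2 * logS n))) (delta := t / 2).
- lra.
- intros u Hu. apply Rabs_def2 in Hu. apply ex_series_log_Dirichlet; lra.
- apply ex_series_Rmult, ex_series_log_Dirichlet, Ht.
- apply ex_series_log_Dirichlet; lra.
- intros n u Hu. rewrite !log_coeff_S.
  pose proof (log_coeff_ge_0 m n) as Hc. pose proof (logS_ge_0 n) as Hl.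
  set (x := - ((u - t) * logS n)).
  replace (- (u * logS n)) with (- (t * logS n) + x) by (unfold x; ring).
  rewrite exp_plus.
  replace (_ - _ - _) with (log_coeff m n * (exp (- (t * logS n)) * (exp x - 1 - x)))
    by (unfold x; ring).
  rewrite !Rabs_mult, (Rabs_pos_eq _ Hc), (Rabs_pos_eq (exp _)) by (left; apply exp_pos).
  rewrite !Rmult_assoc. apply Rmult_le_compat_l; [exact Hc|].
  apply Rle_trans with (exp (- (t * logS n)) * (x ^ 2 * exp (Rabs x))).
  { apply Rmult_le_compat_l; [left; apply exp_pos | apply exp_taylor_1]. }
  apply Rle_trans with (x ^ 2 * exp (- (t / 2 * logS n))).
  + replace (exp (- (t * logS n)) * (x ^ 2 * exp (Rabs x)))
      with (x ^ 2 * exp (- (t * logS n) + Rabs x)) by (rewrite exp_plus; ring).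
    apply Rmult_le_compat_l; [apply pow2_ge_0|]. apply exp_le_compat.
    unfold x. rewrite Rabs_Ropp, Rabs_mult, (Rabs_pos_eq (logS n)) by exact Hl. nra.
  + right. unfold x. ring.
Qed.

End DirichletSeries.

(** * Derivatives of a power series at its centre *)

Lemma iter_PS_derive_0 (m : nat) (p : nat -> R) :
  Nat.iter m PS_derive p 0%nat = INR (fact m) * p m.
Proof.
revert p; induction m as [|m IH]; intros p.
- simpl; ring.
- rewrite Nat.iter_succ_r, IH. unfold PS_derive.
  rewrite fact_simpl, mult_INR. ring.
Qed.

Lemma CV_radius_iter_PS_derive (m : nat) (p : nat -> R) :
  CV_radius (Nat.iter m PS_derive p) = CV_radius p.
Proof.
induction m as [|m IH]; [reflexivity|]. simpl. rewrite CV_radius_derive. exact IH.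
Qed.

Lemma pow_m1_sqr (n : nat) : (-1) ^ n * (-1) ^ n = 1.
Proof.
rewrite <- Rpow_mult_distr. replace (-1 * -1) with 1 by ring. apply pow1.
Qed.

(** On (0, r) each G m is (-1)^m times the m-th derivative of the series; continuity of that
    derivative at 0 gives the one-sided limit. *)
Lemma derivatives_limit_PSeries (G : nat -> R -> R) (p : nat -> R) (r : R) : 0 < r ->
  (forall m t, 0 < t -> is_derive (G m) t (- G (S m) t)) ->
  (forall t, 0 < t < r -> is_pseries p t (G 0%nat t)) ->
  forall m eps, 0 < eps -> exists delta, 0 < delta /\ forall t, 0 < t < delta ->
    Rabs (G m t - (-1) ^ m * (INR (fact m) * p m)) < eps.
Proof.
intros Hr HG H0 m eps Heps.
assert (Hrad : forall t, 0 < t < r -> Rbar_lt (Rabs t) (CV_radius p)).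
(* Convergence at a point strictly between t and r puts t in the open disk. *)
{ intros t Ht. apply Rbar_lt_le_trans with (Rabs ((t + r) / 2)).
  - simpl. rewrite !Rabs_pos_eq; lra.
  - apply CV_radius_ge. exists (G 0%nat ((t + r) / 2)). apply H0; lra. }
assert (Heq : forall m t, 0 < t < r ->
  G m t = (-1) ^ m * PSeries (Nat.iter m PS_derive p) t).
{ induction m0 as [|j IH]; intros t Ht.
  - simpl. rewrite (is_pseries_unique _ _ _ (H0 t Ht)). ring.
  - assert (E : - G (S j) t = (-1) ^ j * PSeries (Nat.iter (S j) PS_derive p) t).
    { rewrite <- (is_derive_unique _ _ _ (HG j t ltac:(lra))).
      apply is_derive_unique.
      apply is_derive_ext_loc with
        (fun t => (-1) ^ j * PSeries (Nat.iter j PS_derive p) t).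
      - assert (Hp : 0 < Rmin t (r - t)) by (apply Rmin_pos; lra).
        exists (mkposreal _ Hp). intros y Hy.
        change (Rabs (y - t) < Rmin t (r - t)) in Hy.
        pose proof (Rmin_l t (r - t)). pose proof (Rmin_r t (r - t)).
        apply Rabs_def2 in Hy. symmetry; apply IH; lra.
      - apply is_derive_scal, is_derive_PSeries.
        rewrite CV_radius_iter_PS_derive. apply Hrad, Ht. }
    simpl ((-1) ^ S j). lra. }
assert (Hcont : continuous (PSeries (Nat.iter m PS_derive p)) 0).
{ apply (ex_derive_continuous (V := R_NormedModule)).
  eexists. apply is_derive_PSeries. rewrite CV_radius_iter_PS_derive, Rabs_R0.
  apply Rbar_le_lt_trans with (Rabs (r / 2)); [apply Rabs_pos | apply Hrad; lra]. }
destruct (proj1 (filterlim_locally _ _) Hcont (mkposreal eps Heps)) as [d Hd].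
exists (Rmin d r). split; [apply Rmin_pos; [apply cond_pos | exact Hr]|].
intros t Ht. pose proof (Rmin_l d r). pose proof (Rmin_r d r).
assert (Hball : ball 0 d t).
{ change (Rabs (t - 0) < d). rewrite Rminus_0_r, Rabs_pos_eq; lra. }
specialize (Hd t Hball).
change (Rabs (PSeries (Nat.iter m PS_derive p) t
              - PSeries (Nat.iter m PS_derive p) 0) < eps) in Hd.
rewrite PSeries_0, iter_PS_derive_0 in Hd.
rewrite Heq, <- Rmult_minus_distr_l, Rabs_mult, <- RPow_abs by lra.
rewrite (Rabs_left (-1)) by lra.
replace (- -1) with 1 by ring. rewrite pow1, Rmult_1_l. exact Hd.
Qed.

Lemma is_derive_principal (q : nat) (c t : R) : 0 < t ->
  is_derive (fun t => c * (INR (fact q) / t ^ (q + 1))) t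
    (- (c * (INR (fact (S q)) / t ^ (S q + 1)))).
Proof.
intros Ht. assert (t ^ (q + 1) <> 0) by (apply pow_nonzero; lra).
evar_last.
- auto_derive; [assumption | reflexivity].
- rewrite fact_simpl, mult_INR. replace (pred (q + 1)) with q by lia.
  replace (S q + 1)%nat with (q + 2)%nat by lia. replace (q + 1)%nat with (S q) by lia.
  rewrite pow_add. simpl (t ^ S q). simpl (t ^ 2).
  assert (t ^ q <> 0) by (apply pow_nonzero; lra). in_R. field; lra.
Qed.

(** * Restriction of complex series to the real axis *)

Lemma is_series_Re_Im (u : nat -> C) (l : C) :
  @is_series C_AbsRing C_NormedModule u l ->
  is_series (fun n => Re (u n)) (Re l) /\ is_series (fun n => Im (u n)) (Im l).
Proof.
intros H. destruct l as [l1 l2]. split.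
- apply (filterlim_ext (fun n => fst (sum_n u n))).
  + induction x as [|n IH]; [rewrite !sum_O; reflexivity|].
    rewrite !sum_Sn, <- IH. reflexivity.
  + apply (filterlim_comp _ _ _ (sum_n u) fst _ (locally (l1, l2))); [exact H|].
    apply (continuous_fst l1 l2).
- apply (filterlim_ext (fun n => snd (sum_n u n))).
  + induction x as [|n IH]; [rewrite !sum_O; reflexivity|].
    rewrite !sum_Sn, <- IH. reflexivity.
  + apply (filterlim_comp _ _ _ (sum_n u) snd _ (locally (l1, l2))); [exact H|].
    apply (continuous_snd l1 l2).
Qed.

Lemma pow_n_RtoC (t : R) (n : nat) : @pow_n C_AbsRing (RtoC t) n = RtoC (t ^ n).
Proof.
induction n as [|n IH]; [reflexivity|].
transitivity (RtoC t * @pow_n C_AbsRing (RtoC t) n)%C; [reflexivity|].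
rewrite IH, <- RtoC_mult. reflexivity.
Qed.

Lemma is_pseries_Re_Im (a : nat -> C) (t : R) (l : C) :
  @is_pseries C_AbsRing C_NormedModule a (RtoC t) l ->
  is_pseries (fun n => Re (a n)) t (Re l) /\ is_pseries (fun n => Im (a n)) t (Im l).
Proof.
intros H. apply is_series_Re_Im in H as [H1 H2].
split; apply (proj2 (is_pseries_R _ _ _)).
- apply is_series_ext with (2 := H1). intros n.
  transitivity (Re (@pow_n C_AbsRing (RtoC t) n * a n)%C); [reflexivity|].
  rewrite pow_n_RtoC, re_scal_l. apply Rmult_comm.
- apply is_series_ext with (2 := H2). intros n.
  transitivity (Im (@pow_n C_AbsRing (RtoC t) n * a n)%C); [reflexivity|].
  rewrite pow_n_RtoC, im_scal_l. apply Rmult_comm.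
Qed.

Lemma nat_Cpow_real (n : nat) (s : R) :
  nat_Cpow (S n) (- RtoC s)%C = RtoC (exp (- (s * logS n))).
Proof.
unfold nat_Cpow. fold (logS n).
replace (- RtoC s * RtoC (logS n))%C with (RtoC (- (s * logS n)))
  by (rewrite RtoC_opp, RtoC_mult; ring).
unfold Cexp, RtoC; simpl. rewrite cos_0, sin_0, Rmult_1_r, Rmult_0_r. reflexivity.
Qed.

(** * Identification with the Laurent coefficients *)

Lemma Laurent_coefficient (k m : nat) (A : nat -> R) (Z : C -> C) (g : nat -> C) (L : R) :
  (1 <= k)%nat -> (forall n, 0 <= A (S n) <= 1 + logS n) ->
  is_zeta_A A Z -> is_gamma_A k Z g ->
  is_series (fun n => log_coeff A m n
                      - (main_term k m (logS (S n)) - main_term k m (logS n))) L ->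
  g m = RtoC L.
Proof.
intros hk HA [_ HZ] [r Hr] HL.
assert (Hk : 0 < INR k) by (apply lt_0_INR; lia).
assert (HZt : forall t, 0 < t ->
  Z (RtoC (1 + t)) = RtoC (log_Dirichlet A 0 t)).
{ intros t Ht. specialize (HZ (RtoC (1 + t)) ltac:(simpl; lra)).
  apply is_series_Re_Im in HZ as [H1 H2].
  apply injective_projections.
  - apply is_series_unique in H1. unfold Re in H1 at 2. simpl. rewrite <- H1.
    apply Series_ext. intros n.
    rewrite nat_Cpow_real, <- RtoC_mult, re_RtoC. unfold log_coeff.
    replace (- ((1 + t) * logS n)) with (- logS n + - (t * logS n)) by ring.
    rewrite exp_plus. simpl. ring.
  - apply is_series_unique in H2. unfold Im in H2 at 2. simpl. rewrite <- H2.
    rewrite (Series_ext _ (fun _ => 0 * 0)).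
    + rewrite Series_scal_l. ring.
    + intros n. rewrite nat_Cpow_real, <- RtoC_mult, im_RtoC. ring. }
set (c2 := / INR k). set (c1 := euler_gamma / INR k).
set (G := fun j t => log_Dirichlet A j t - c2 * (INR (fact (j + 1)) / t ^ (j + 1 + 1))
                     - c1 * (INR (fact j) / t ^ (j + 1))).
(* Z is real on the ray, so the real parts of the coefficients sum to [G 0] and the imaginary parts
   to 0. *)
assert (HP : forall t, 0 < t < r ->
  is_pseries (fun j => (-1) ^ j / INR (fact j) * Re (g j)) t (G 0%nat t) /\
  is_pseries (fun j => (-1) ^ j / INR (fact j) * Im (g j)) t 0).
{ intros t Ht.
  assert (Hball : ball (RtoC 1) r (RtoC (1 + t))).
  { split.
    - change (Rabs (1 + t - 1) < r). replace (1 + t - 1) with t by ring.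
      rewrite Rabs_pos_eq; lra.
    - change (Rabs (0 - 0) < r). rewrite Rminus_0_r, Rabs_R0; lra. }
  assert (Hne : RtoC (1 + t) <> RtoC 1).
  { intros E. apply RtoC_inj in E. lra. }
  specialize (Hr _ Hball Hne). rewrite HZt in Hr by lra.
  assert (Es : (RtoC (1 + t) - RtoC 1)%C = RtoC t).
  { rewrite <- RtoC_minus. f_equal. ring. }
  rewrite Es in Hr.
  assert (Ht2 : INR k * t ^ 2 <> 0)
    by (apply Rmult_integral_contrapositive; split; [lra | apply pow_nonzero; lra]).
  assert (Ht1 : INR k * t <> 0)
    by (apply Rmult_integral_contrapositive; lra).
  replace (RtoC (log_Dirichlet A 0 t) - RtoC 1 / (RtoC (INR k) * RtoC t ^ 2)
     - RtoC euler_gamma / (RtoC (INR k) * RtoC t))%C with (RtoC (G 0%nat t)) in Hr.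
  2:{ rewrite <- RtoC_pow, <- !RtoC_mult, <- !RtoC_div, <- !RtoC_minus by assumption.
      f_equal. unfold G, c2, c1. simpl. field. lra. }
  apply is_pseries_Re_Im in Hr as [H1 H2].
  rewrite re_RtoC in H1. rewrite im_RtoC in H2.
  assert (Ec : forall j, (RtoC ((-1) ^ j) * g j / RtoC (INR (fact j)))%C
                         = (RtoC ((-1) ^ j / INR (fact j)) * g j)%C).
  { intros j. rewrite RtoC_div by apply INR_fact_neq_0. unfold Cdiv. ring. }
  split.
  - apply (is_pseries_ext _ _ _ _) with (2 := H1). intros j. rewrite Ec. apply re_scal_l.
  - apply (is_pseries_ext _ _ _ _) with (2 := H2). intros j. rewrite Ec. apply im_scal_l. }
assert (HG : forall j t, 0 < t -> is_derive (G j) t (- G (S j) t)).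
{ intros j t Ht. unfold G.
  evar_last.
  - apply (is_derive_minus (fun t => log_Dirichlet A j t
        - c2 * (INR (fact (j + 1)) / t ^ (j + 1 + 1)))
      (fun t => c1 * (INR (fact j) / t ^ (j + 1)))).
    + apply (is_derive_minus (log_Dirichlet A j)
        (fun t => c2 * (INR (fact (j + 1)) / t ^ (j + 1 + 1)))).
      * apply is_derive_log_Dirichlet; [exact HA | exact Ht].
      * apply is_derive_principal, Ht.
    + apply is_derive_principal, Ht.
  - unfold minus, plus, opp; simpl (AbelianMonoid.plus _ _).
    replace (S j + 1)%nat with (S (j + 1)) by lia.
    cbn -[INR fact pow log_Dirichlet Nat.add]. in_R. ring. }
(* The sign from m differentiations cancels the (-1)^m in the Laurent expansion, and m! cancels
   likewise. *)
assert (Hfact : (-1) ^ m * (INR (fact m) * ((-1) ^ m / INR (fact m) * Re (g m))) = Re (g m)).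
{ transitivity ((-1) ^ m * (-1) ^ m * Re (g m)).
  - field. apply INR_fact_neq_0.
  - rewrite pow_m1_sqr. ring. }
assert (HRe : Re (g m) = L).
{ apply Rminus_diag_uniq, cond_eq. intros eps Heps.
  destruct (derivatives_limit_PSeries G _ r (cond_pos r) HG
    (fun t Ht => proj1 (HP t Ht)) m (eps / 4)) as (d1 & Hd1 & H1); [lra|].
  destruct (abel_limit k m (log_coeff A m) L HL
    (ex_series_log_Dirichlet A HA m) (eps / 4)) as (d2 & Hd2 & H2); [lra|].
  rewrite Hfact in H1.
  set (t := Rmin d1 d2 / 2).
  assert (Ht : 0 < Rmin d1 d2) by now apply Rmin_pos.
  pose proof (Rmin_l d1 d2). pose proof (Rmin_r d1 d2).
  specialize (H1 t ltac:(unfold t; lra)). specialize (H2 t ltac:(unfold t; lra)).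
  fold c2 c1 in H2. fold (log_Dirichlet A m t) in H2.
  replace (m + 2)%nat with (m + 1 + 1)%nat in H2 by lia. fold (G m t) in H2.
  rewrite Rminus_0_r.
  replace (Re (g m) - L) with ((G m t - L) - (G m t - Re (g m))) by ring.
  eapply Rle_lt_trans; [apply Rabs_triang|]. rewrite Rabs_Ropp.
  change (log_Dirichlet A m t - c2 * (INR (fact (m + 1)) / t ^ (m + 1 + 1))
          - c1 * (INR (fact m) / t ^ (m + 1))) with (G m t) in H2.
  lra. }
assert (HIm : Im (g m) = 0).
{ assert (Hfi : (-1) ^ m * (INR (fact m) * ((-1) ^ m / INR (fact m) * Im (g m))) = Im (g m)).
  { transitivity ((-1) ^ m * (-1) ^ m * Im (g m)).
    - field. apply INR_fact_neq_0.
    - rewrite pow_m1_sqr. ring. }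
  apply cond_eq. intros eps Heps.
  (* The zero family satisfies G_m' = - G_(m+1) and is the sum of the imaginary series, so the same
     lemma forces its coefficients to vanish. *)
  destruct (derivatives_limit_PSeries (fun _ _ => 0) _ r (cond_pos r)
    (fun j t _ => eq_ind_r (is_derive (fun _ => 0) t) (is_derive_const 0 t) Ropp_0)
    (fun t Ht => proj2 (HP t Ht)) m eps Heps) as (d1 & Hd1 & H1).
  specialize (H1 (d1 / 2) ltac:(lra)). rewrite Hfi in H1.
  rewrite Rminus_0_r. rewrite Rminus_0_l, Rabs_Ropp in H1. exact H1. }
apply injective_projections; assumption.
Qed.

(** * From partial sums to real x *)

Lemma main_term_0 (k m : nat) : main_term k m 0 = 0.
Proof.
unfold main_term, log_primitive. rewrite !pow_i by lia. unfold Rdiv. ring.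
Qed.

(** Telescoping evaluates the main term at log (N+2), although the sum stops at the integer N+1;
    [main_gap] pays for this offset. *)
Lemma sum_n_main_term (k m : nat) (b : nat -> R) (N : nat) :
  sum_n (fun n => b n - (main_term k m (logS (S n)) - main_term k m (logS n))) N
  = sum_n b N - main_term k m (logS (S N)).
Proof.
induction N as [|N IH].
- rewrite !sum_O, logS_0, main_term_0. in_R. ring.
- rewrite !sum_Sn, IH. unfold plus; simpl (AbelianMonoid.plus _ _).
  cbn -[main_term logS]. in_R. ring.
Qed.

Lemma main_term_diff_le (k m : nat) (u y v : R) : 0 <= u <= y -> y <= v ->
  Rabs (main_term k m v - main_term k m y) <=
    Rabs (/ INR k) * (log_primitive (m + 1) v - log_primitive (m + 1) u)
    + Rabs (euler_gamma / INR k) * (log_primitive m v - log_primitive m u).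
Proof.
intros Hu Hv.
replace (main_term k m v - main_term k m y) with
  (/ INR k * (log_primitive (m + 1) v - log_primitive (m + 1) y)
   + euler_gamma / INR k * (log_primitive m v - log_primitive m y))
  by (unfold main_term; ring).
eapply Rle_trans; [apply Rabs_triang|]. rewrite !Rabs_mult.
assert (H : forall p, Rabs (log_primitive p v - log_primitive p y)
                      <= log_primitive p v - log_primitive p u).
{ intros p. pose proof (log_primitive_incr p u y Hu).
  pose proof (log_primitive_incr p y v ltac:(lra)).
  rewrite Rabs_pos_eq; lra. }
apply Rplus_le_compat; apply Rmult_le_compat_l; try apply Rabs_pos; apply H.
Qed.

Lemma nat_floor_bounds (x : R) : 0 <= x ->
  INR (nat_floor x) <= x < INR (nat_floor x) + 1.
Proof.
intros Hx. destruct (base_Int_part x) as [H1 H2].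
assert (H0 : (0 <= Int_part x)%Z).
{ assert (-1 < IZR (Int_part x)) by lra. apply lt_IZR in H. lia. }
unfold nat_floor. rewrite INR_IZR_INZ, Z2Nat.id by exact H0. lra.
Qed.

Theorem theorem10 (k m : nat) (hk : (1 <= k)%nat)
  (A : nat -> R) (hA : is_A_coeffs k A)
  (Z : C -> C) (hZ : is_zeta_A A Z)
  (g : nat -> C) (hg : is_gamma_A k Z g) :
  filterlim
    (fun x : R => RtoC
       (sum_n_m (fun n => A n * ln (INR n) ^ m / INR n) 1 (nat_floor x)
        - 1 / INR k * (ln x ^ (m + 2) / INR (m + 2))
        - euler_gamma / INR k * (ln x ^ (m + 1) / INR (m + 1))))
    (Rbar_locally p_infty) (locally (g m)).
Proof.
destruct (A_coeffs_recurrence k A hk hA) as [A_0 A_S].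
pose proof (A_le_logS k A hk A_0 A_S) as A_le.
destruct (ex_series_A_main_term k A hk A_0 A_S m) as [L HL].
rewrite (Laurent_coefficient k m A Z g L hk A_le hZ hg HL).
set (c := fun n => log_coeff A m n
                   - (main_term k m (logS (S n)) - main_term k m (logS n))).
change (is_lim_seq (sum_n c) L) in HL.
assert (Hx := is_lim_seq_main_gap k m _ L HL).
apply filterlim_locally. intros eps.
apply is_lim_seq_spec in Hx. destruct (Hx eps) as [N1 HN1].
(* Beyond N1 + 1 the floor of y is some N+1 with N >= N1. *)
exists (INR N1 + 1). intros y Hy. pose proof (pos_INR N1) as HN1p.
destruct (nat_floor_bounds y ltac:(lra)) as [Hf1 Hf2].
destruct (nat_floor y) as [|N] eqn:EN; [simpl in Hf2; lra|].
assert (HN : (N1 <= N)%nat).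
{ rewrite S_INR in Hf2. assert (INR N1 < INR (S N)) by (rewrite S_INR; lra).
  apply INR_lt in H. lia. }
assert (HSN : 0 < INR (S N)) by (apply lt_0_INR; lia).
assert (Hl1 : logS N <= ln y) by now apply ln_le.
assert (Hl2 : ln y <= logS (S N)) by (apply ln_le; [|rewrite (S_INR (S N))]; lra).
assert (Eval : sum_n_m (fun n => A n * ln (INR n) ^ m / INR n) 1 (S N)
        - 1 / INR k * (ln y ^ (m + 2) / INR (m + 2))
        - euler_gamma / INR k * (ln y ^ (m + 1) / INR (m + 1))
   = sum_n c N + (main_term k m (logS (S N)) - main_term k m (ln y))).
{ unfold c. rewrite sum_n_main_term. rewrite <- sum_n_m_S.
  change (sum_n_m (fun n => A (S n) * ln (INR (S n)) ^ m / INR (S n)) 0 N)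
    with (sum_n (fun n => A (S n) * logS n ^ m / INR (S n)) N).
  rewrite (sum_n_ext (fun n => A (S n) * logS n ^ m / INR (S n)) (log_coeff A m)).
  - generalize (main_term k m (logS (S N))); intros M. unfold main_term, log_primitive.
    replace (m + 1 + 1)%nat with (m + 2)%nat by lia. unfold Rdiv. ring.
  - intros n. unfold log_coeff. rewrite exp_opp_logS. reflexivity. }
rewrite Eval.
specialize (HN1 N HN). rewrite Rminus_0_r in HN1. apply Rabs_def2 in HN1 as [HN1 _].
pose proof (main_term_diff_le k m (logS N) (ln y) (logS (S N))
  (conj (logS_ge_0 N) Hl1) Hl2) as Hdiff.
(* A ball of C is a product of balls: the real coordinate carries the estimate, the imaginary one is
   0 on both sides. *)
split.
- change (Rabs (sum_n c N + (main_term k m (logS (S N)) - main_term k m (ln y)) - L) < eps).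
  replace (sum_n c N + (main_term k m (logS (S N)) - main_term k m (ln y)) - L)
    with (sum_n c N - L + (main_term k m (logS (S N)) - main_term k m (ln y))) by ring.
  eapply Rle_lt_trans; [apply Rabs_triang|].
  unfold main_gap in HN1. lra.
- change (Rabs (0 - 0) < eps). rewrite Rminus_0_r, Rabs_R0. apply cond_pos.
Qed.
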